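(* Let $n,m$ be coprime integers with $2\le n<m$, let $\mathcal{M}(n,m)$ be the monoid with generators $\rho_1,\dots,\rho_n$ and relations $\rho_1\rho_n^q\rho_i=\rho_{i+1}\rho_n^{q+D(i)}$ for $1\le i\le n-1$ (with $q$ and $D(i)$ as in the context), and let $\Delta:=\rho_n^m\in\mathcal{M}(n,m)$. Then the pair $(\mathcal{M}(n,m),\Delta)$ is a Garside monoid, and its Garside group (the group of fractions of $\mathcal{M}(n,m)$) is isomorphic to the $(n,m)$-torus knot group $G(n,m)$.
   Context: Notation: write $m=qn+r$ for the Euclidean division of $m$ by $n$, so $0<r<n$. For $i\in\mathbb{Z}$ let $k_i$ be the unique integer in $\{1,\dots,n\}$ with $k_i\equiv ir \pmod n$, and let $D(i):=\frac{r+k_i-k_{i+1}}{n}$, which equals $1$ if $k_i+r>n$ and $0$ otherwise. $G(n,m)$ is the knot group of the torus knot $T_{n,m}$; it has the well-known presentation $\langle x,y\mid x^n=y^m\rangle$. In a monoid $M$, if $ab=c$ then $a$ is a left-divisor of $c$, $b$ a right-divisor of $c$, $c$ a right-multiple of $a$ and a left-multiple of $b$. A right-lcm of two elements is a common right-multiple that left-divides every common right-multiple; a left-gcd is a common left-divisor that is left-divisible by every common left-divisor; left-lcms and right-gcds are defined symmetrically. The divisibility in $M$ is Noetherian if there is $\lambda:M\to\mathbb{Z}_{\ge0}$ with $\lambda(ab)\ge\lambda(a)+\lambda(b)$ for all $a,b$ and $\lambda(a)\ne0$ whenever $a\ne1$. A Garside monoid is a pair $(M,\Delta)$ with $M$ a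 monoid and $\Delta\in M$ such that: (1) $M$ is left- and right-cancellative; (2) the divisibility in $M$ is Noetherian; (3) any two elements of $M$ admit a left- and a right-lcm and a left- and a right-gcd; (4) the sets of left- and right-divisors of $\Delta$ coincide and generate $M$; (5) the set of divisors of $\Delta$ is finite. Such an $M$ embeds in its group of fractions (Ore), which is called its Garside group. *)

(* Defs.v *)
From HB Require Import structures.
From mathcomp Require Import all_boot.
From mathcomp Require Import boolp classical_sets cardinality.

Set Implicit Arguments.
Unset Strict Implicit.
Unset Printing Implicit Defensive.

Local Open Scope quotient_scope.
Local Open Scope group_scope.

Section PresentedMonoid.
Variables (I : choiceType) (R : seq I -> seq I -> Prop).

(* The least monoid congruence on the free monoid [seq I] containing [R]. *)
Inductive pcong : seq I -> seq I -> Prop :=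
| pcong_rel u v l r : R l r -> pcong (u ++ l ++ v) (u ++ r ++ v)
| pcong_refl u : pcong u u
| pcong_sym u v : pcong u v -> pcong v u
| pcong_trans v u w : pcong u v -> pcong v w -> pcong u w.

Definition pcongb : rel (seq I) := fun u v => `[< pcong u v >].

Lemma pcongb_refl : reflexive pcongb.
Proof. by move=> u; apply/asboolP; apply: pcong_refl. Qed.

Lemma pcongb_sym : symmetric pcongb.
Proof. by move=> u v; apply/asboolP/asboolP; apply: pcong_sym. Qed.

Lemma pcongb_trans : transitive pcongb.
Proof.
move=> v u w /asboolP uv /asboolP vw; apply/asboolP; apply: pcong_trans uv vw.
Qed.

Canonical pcong_equiv := EquivRel pcongb pcongb_refl pcongb_sym pcongb_trans.

Definition presented_monoid := {eq_quot pcong_equiv}.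

HB.instance Definition _ := Choice.on presented_monoid.

Definition word_class (u : seq I) : presented_monoid :=
  \pi_({eq_quot pcong_equiv}) u.
Definition word_repr (a : presented_monoid) : seq I :=
  repr (a : {eq_quot pcong_equiv}).

Lemma word_reprK : cancel word_repr word_class.
Proof. by move=> a; apply: reprK. Qed.

Lemma word_classP u v : word_class u = word_class v <-> pcong u v.
Proof.
split=> [/eqmodP /asboolP //|uv]; by apply/eqmodP; apply/asboolP.
Qed.

Lemma word_classK u : pcong (word_repr (word_class u)) u.
Proof. by apply/word_classP; rewrite word_reprK. Qed.

Lemma pcong_cat u u' v v' :
  pcong u u' -> pcong v v' -> pcong (u ++ v) (u' ++ v').
Proof.
move=> uu' vv'; apply: (@pcong_trans (u' ++ v)).
  elim: uu' v {vv'} => {u u'} [u w l r lr|u|u v _ IH|v u w _ IH1 _ IH2] t.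
  - by rewrite -!catA; apply: pcong_rel.
  - exact: pcong_refl.
  - exact: pcong_sym.
  - exact: pcong_trans (IH1 t) (IH2 t).
elim: vv' => {v v'} [v w l r lr|v|v w _ IH|v w t _ IH1 _ IH2].
- by rewrite !(catA u'); apply: pcong_rel.
- exact: pcong_refl.
- exact: pcong_sym.
- exact: pcong_trans IH1 IH2.
Qed.

Definition pmul (a b : presented_monoid) : presented_monoid :=
  word_class (word_repr a ++ word_repr b).

Lemma word_class_cat u v :
  pmul (word_class u) (word_class v) = word_class (u ++ v).
Proof. by apply/word_classP; apply: pcong_cat; apply: word_classK. Qed.

Lemma pmulA : associative pmul.
Proof.
move=> a b c; rewrite -(word_reprK a) -(word_reprK b) -(word_reprK c).
by rewrite !word_class_cat catA.
Qed.

Lemma pmul1 : left_id (word_class [::]) pmul.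
Proof. by move=> a; rewrite -(word_reprK a) word_class_cat. Qed.

Lemma pmulr1 : right_id (word_class [::]) pmul.
Proof. by move=> a; rewrite -(word_reprK a) word_class_cat cats0. Qed.

HB.instance Definition _ := isMonoid.Build presented_monoid pmulA pmul1 pmulr1.

Definition pgen (i : I) : presented_monoid := word_class [:: i].

End PresentedMonoid.

Section PresentedGroup.
Variable I : choiceType.

(* Group words: [(i, false)] is the generator [i], [(i, true)] its inverse. *)
Variable R : seq (I * bool) -> seq (I * bool) -> Prop.

Inductive group_rel : seq (I * bool) -> seq (I * bool) -> Prop :=
| group_rel_rel u v : R u v -> group_rel u v
| group_rel_inv i b : group_rel [:: (i, b); (i, ~~ b)] [::].

Definition presented_group := presented_monoid group_rel.

HB.instance Definition _ := Monoid.on presented_group.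

Definition word_inv (u : seq (I * bool)) := rev [seq (x.1, ~~ x.2) | x <- u].

Lemma word_invK : involutive word_inv.
Proof.
move=> u; rewrite /word_inv map_rev revK -map_comp.
by rewrite -[RHS]map_id; apply: eq_map => -[i b] /=; rewrite negbK.
Qed.

Lemma pcong_word_inv u : pcong group_rel (u ++ word_inv u) [::].
Proof.
elim: u => [|[i b] u IH]; first exact: pcong_refl.
rewrite /word_inv /= rev_cons -cats1 -/(word_inv u).
apply: (@pcong_trans _ _ [:: (i, b); (i, ~~ b)]).
  rewrite -cat1s -[[:: (i, b); _]]/([:: (i, b)] ++ [::] ++ [:: (i, ~~ b)]).
  rewrite catA -!catA; apply: pcong_cat; first exact: pcong_refl.
  by rewrite catA; apply: pcong_cat => //; apply: pcong_refl.
exact: (@pcong_rel _ _ [::] [::] _ _ (group_rel_inv i b)).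
Qed.

Definition pinv (a : presented_group) : presented_group :=
  word_class group_rel (word_inv (word_repr a)).

Lemma pmulrV (a : presented_group) : a * pinv a = 1.
Proof.
rewrite -{1}(word_reprK a).
by rewrite [LHS]word_class_cat; apply/word_classP; apply: pcong_word_inv.
Qed.

Lemma pmulVr (a : presented_group) : pinv a * a = 1.
Proof.
rewrite -{2}(word_reprK a) [LHS]word_class_cat; apply/word_classP.
by rewrite -{2}[word_repr a]word_invK; apply: pcong_word_inv.
Qed.

HB.instance Definition _ := hasInv.Build presented_group pinv.
HB.instance Definition _ := Monoid_isGroup.Build presented_group pmulVr pmulrV.

End PresentedGroup.

Section Garside.
Variable M : monoidType.
Implicit Types a b c : M.

Definition left_divides a c := exists b, c = a * b.
Definition right_divides b c := exists a, c = a * b.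

(* For [div := left_divides] these are right-lcms and left-gcds; for
   [div := right_divides] they are left-lcms and right-gcds. *)
Definition is_lcm (div : M -> M -> Prop) a b c :=
  [/\ div a c, div b c & forall d, div a d -> div b d -> div c d].
Definition is_gcd (div : M -> M -> Prop) a b c :=
  [/\ div c a, div c b & forall d, div d a -> div d b -> div d c].

Definition has_lcms_gcds (div : M -> M -> Prop) :=
  forall a b, (exists c, is_lcm div a b c) /\ (exists c, is_gcd div a b c).

Definition noetherian_divisibility :=
  exists lambda : M -> nat,
    (forall a b, lambda a + lambda b <= lambda (a * b)%g)%N /\
    (forall a, a <> 1 -> lambda a <> 0%N).

Definition generates (S : set M) :=
  forall x : M, exists2 s : seq M,
    (forall y, y \in s -> S y) & x = \prod_(y <- s) y.

Record is_garside_monoid (Delta : M) : Prop := IsGarsideMonoid {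
  garside_cancel_left : forall a b c, a * b = a * c -> b = c;
  garside_cancel_right : forall a b c, b * a = c * a -> b = c;
  garside_noetherian : noetherian_divisibility;
  garside_lcm_gcd_left : has_lcms_gcds left_divides;
  garside_lcm_gcd_right : has_lcms_gcds right_divides;
  garside_divisors : forall a, left_divides a Delta <-> right_divides a Delta;
  garside_generates : generates [set a | left_divides a Delta];
  garside_finite : finite_set [set a | left_divides a Delta]
}.

(* [G], with the embedding [iota], is the group of fractions of [M]; by Ore's
   theorem it is unique up to isomorphism when it exists. *)
Record is_group_of_fractions (G : groupType) (iota : M -> G) : Prop :=
  IsGroupOfFractions {
  fractions_morphism : monoid_morphism iota;
  fractions_injective : injective iota;
  fractions_surjective : forall g : G, exists a b, g = iota a * (iota b)^-1
}.

End Garside.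

Definition isomorphic_groups (G H : groupType) :=
  exists f : {multiplicative G -> H}, bijective f.

Local Open Scope nat_scope.

(* Here [n] and [m] are as in m = q n + r, so [q] is [m %/ n] and [r] is
   [m %% n]. *)
Section TorusKnot.
Variables n m : nat.

(* The residue of i r modulo n, taken in {1, ..., n}. *)
Definition kres (i : nat) : nat :=
  if n %| i * (m %% n) then n else (i * (m %% n)) %% n.

Lemma kres_bounds i : 0 < n -> 0 < kres i <= n.
Proof.
move=> n_gt0; rewrite /kres; case: ifPn => [_|]; first by rewrite n_gt0 leqnn.
by rewrite /dvdn -lt0n => ->; rewrite ltnW ?ltn_pmod.
Qed.

Lemma kres_mod i : kres i = i * (m %% n) %[mod n].
Proof. by rewrite /kres; case: ifP => [/eqP ->|_]; rewrite ?modnn ?modn_mod. Qed.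

(* The truncated subtraction and the division are exact, see [DexpE]. *)
Definition Dexp (i : nat) : nat := (m %% n + kres i - kres i.+1) %/ n.

Lemma kresS i : 0 < n ->
  m %% n + kres i = kres i.+1 + (n < kres i + m %% n) * n.
Proof.
move=> n_gt0; have r_lt := ltn_pmod m n_gt0.
have /andP[k0 kn] := kres_bounds i n_gt0.
have /andP[k'0 k'n] := kres_bounds i.+1 n_gt0.
have E : m %% n + kres i = kres i.+1 %[mod n].
  by rewrite kres_mod mulSn -modnDmr kres_mod modnDmr.
move: r_lt k0 kn k'0 k'n E; move: (kres i) (kres i.+1) (m %% n) => k k' r.
move=> r_lt k0 kn k'0 k'n E; rewrite addnC.
have uniq_res x : 0 < x <= n -> x = k' %[mod n] -> x = k'.
  case/andP=> x0 xn; case: (ltngtP x n) xn => // [xn|->] _; last first.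
    rewrite modnn; case: (ltngtP k' n) k'n => // k'n _.
    by rewrite modn_small // => k'E; rewrite -k'E in k'0.
  rewrite modn_small //; case: (ltngtP k' n) k'n => // [k'n|->] _.
    by rewrite modn_small.
  by rewrite modnn => xE; rewrite xE in x0.
case: (ltnP n (k + r)) => krn; rewrite ?mul1n ?mul0n ?addn0.
  rewrite -(subnK (ltnW krn)); congr (_ + _); apply: uniq_res.
    rewrite subn_gt0 krn leq_subLR; exact: leq_add (ltnW r_lt).
  by rewrite -E -modnDr subnK ?(ltnW krn) // addnC.
by apply: uniq_res; [rewrite addn_gt0 k0 krn | rewrite addnC].
Qed.

Lemma DexpE i : 0 < n -> Dexp i = (n < kres i + m %% n).
Proof. by move=> n_gt0; rewrite /Dexp kresS // addKn mulnK. Qed.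

(* Generators are indexed by ['I_n.-1.+1], that is ['I_n] for [0 < n], so that
   [inord] is available; [rho i], meant for 1 <= i <= n, is rho_i. *)
Definition rho (i : nat) : 'I_n.-1.+1 := inord i.-1.

Inductive torus_monoid_rel : seq 'I_n.-1.+1 -> seq 'I_n.-1.+1 -> Prop :=
| TorusMonoidRel i : 1 <= i <= n.-1 ->
    torus_monoid_rel
      (rho 1 :: nseq (m %/ n) (rho n) ++ [:: rho i])
      (rho i.+1 :: nseq (m %/ n + Dexp i) (rho n)).

Definition torus_monoid := presented_monoid torus_monoid_rel.
HB.instance Definition _ := Monoid.on torus_monoid.

Definition torus_Delta : torus_monoid :=
  ((pgen torus_monoid_rel (rho n) : torus_monoid) ^+ m)%g.

(* < x, y | x^n = y^m >, with generators x = [true] and y = [false]. *)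
Inductive torus_knot_group_rel : seq (bool * bool) -> seq (bool * bool) -> Prop :=
| TorusKnotGroupRel :
    torus_knot_group_rel (nseq n (true, false)) (nseq m (false, false)).

Definition torus_knot_group := presented_group torus_knot_group_rel.
HB.instance Definition _ := Group.on torus_knot_group.

End TorusKnot.

(* Main.v *)
From HB Require Import structures.
Require Import Defs.
From mathcomp Require Import all_boot.
From mathcomp Require Import boolp classical_sets cardinality.
From mathcomp Require Import zify.

(* Put x := rho_1 rho_n^q and y := rho_n. The relations say that
   x^i = rho_i y^(alpha i) with alpha i = ceil(i m / n) - 1, so that rho_i has
   weight k_i = i m - n (alpha i) > 0 and x^n = y^m = Delta is central. For i < j
   the elements rho_i and rho_j have the common multiple
   x^i rho_(j-i) = rho_j y^(alpha j - alpha (j-i)), and the resulting system of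
   complements satisfies the cube condition: by induction on the weight, any
   equality rho_i a = rho_j b factors through it. Left-cancellation and
   right-lcms follow by Garside's argument, and the remaining axioms from Delta
   being a central common multiple. For the group, send rho_i to
   x^i y^(- alpha i): evaluating a group word to a numerator in the monoid and a
   power of Delta shows that this embeds the monoid, and every element of the
   knot group is such a fraction. *)

Set Implicit Arguments.
Unset Strict Implicit.
Unset Printing Implicit Defensive.

(** * Divisibility in a monoid *)

Section Divisibility.
Local Open Scope group_scope.
Variable M : monoidType.
Implicit Types a b c d e : M.

Lemma left_divides1 a : left_divides 1 a.
Proof. by exists a; rewrite mul1g. Qed.

Lemma left_divides_refl a : left_divides a a.
Proof. by exists 1; rewrite mulg1. Qed.

Lemma left_divides_trans b a c :
  left_divides a b -> left_divides b c -> left_divides a c.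
Proof. by move=> [u ->] [v ->]; exists (u * v); rewrite mulgA. Qed.

Lemma left_divides_mul2l c a b : left_divides a b -> left_divides (c * a) (c * b).
Proof. by move=> [u ->]; exists u; rewrite mulgA. Qed.

Lemma right_divides_trans b a c :
  right_divides a b -> right_divides b c -> right_divides a c.
Proof. by move=> [u ->] [v ->]; exists (v * u); rewrite mulgA. Qed.

End Divisibility.

(** * Cancellation and right-lcms from complements of generators *)

Section ComplementedMonoid.
Local Open Scope group_scope.
Variables (M : monoidType) (I : Type) (g : I -> M) (C : I -> I -> M).
Variable lambda : M -> nat.
Hypothesis lambdaM : forall a b : M, lambda (a * b) = (lambda a + lambda b)%N.
Hypothesis lambda_gt0 : forall i, (0 < lambda (g i))%N.
Hypothesis gP : forall a, a = 1 \/ exists i b, a = g i * b.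
(** [gC] makes [g i * C i j] a common right-multiple of [g i] and [g j]; [gK] makes it their
    right-lcm. *)
Hypothesis gC : forall i j, g i * C i j = g j * C j i.
Hypothesis gK : forall i j a b, g i * a = g j * b ->
  exists2 t, a = C i j * t & b = C j i * t.
Implicit Types a b c d e : M.

Lemma lambda_eq0 a : lambda a = 0%N -> a = 1.
Proof.
by case: (gP a) => [//|[i [b ->]]]; rewrite lambdaM; have := lambda_gt0 i; lia.
Qed.

(** Induction on the weight, which drops whenever a generator is split off. *)
Lemma gen_ind (P : M -> Prop) :
  P 1 -> (forall i a, P a -> P (g i * a)) -> forall a, P a.
Proof.
move=> P1 Pg a; have [N leN] := ubnP (lambda a); elim: N => // N IH in a leN *.
case: (gP a) => [->//|[i [b aE]]]; rewrite aE; apply/Pg/IH.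
by move: leN; rewrite aE lambdaM; have := lambda_gt0 i; lia.
Qed.

Hypothesis Cii : forall i, C i i = 1.

(** For i = j both complements are 1, so [gK] cancels one generator at a time. *)
Lemma complemented_cancel a b c : a * b = a * c -> b = c.
Proof.
elim/gen_ind: a => [|i a IH]; first by rewrite !mul1g.
rewrite -!mulgA => /gK[t]; rewrite Cii !mul1g => bE cE.
by apply: IH; rewrite bE cE.
Qed.

(* Induction on the weight of the common multiple [c]: first complete [i] and
   [j] to their lcm, then absorb the remaining factors of [a] and [b] one after
   the other. *)
Lemma complemented_lcm a b c : left_divides a c -> left_divides b c ->
  exists l, is_lcm (@left_divides M) a b l.
Proof.
have [N leN] := ubnP (lambda c); elim: N => // N IH in a b c leN *.
case: (gP a) => [->|[i [a' ->]]] ac bc.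
  by exists b; split=> //; [apply: left_divides1 | apply: left_divides_refl].
case: (gP b) bc => [->|[j [b' ->]]] bc.
  exists (g i * a'); split=> //; first exact: left_divides_refl.
  exact: left_divides1.
have {ac} [u cE] := ac; have {bc} [v cE'] := bc.
rewrite -!mulgA in cE cE'.
have [t ci cj] := gK (etrans (esym cE) cE').
have lti : (lambda (C i j * t) < N)%N.
  by move: leN; rewrite cE -ci lambdaM; have := lambda_gt0 i; lia.
have ltj : (lambda (C j i * t) < N)%N.
  by move: leN; rewrite cE' -cj lambdaM; have := lambda_gt0 j; lia.
have [||e [ae' [e' eE] emin]] := IH a' (C i j) _ lti; first by exists u.
  by exists t.
have [s tE] : left_divides e' t.
  have [||s] := emin (C i j * t); [by exists u | by exists t|].
  by rewrite eE -mulgA => /complemented_cancel ->; exists s.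
have [||f [bf ef fmin]] := IH b' (C j i * e') _ ltj; first by exists v.
  by exists s; rewrite tE mulgA.
exists (g j * f); split.
- apply: (@left_divides_trans _ (g i * (C i j * e'))).
    by rewrite -eE; apply: left_divides_mul2l.
  by rewrite mulgA gC -mulgA; apply: left_divides_mul2l.
- exact: left_divides_mul2l.
move=> d [x dE] [y dE']; rewrite -!mulgA in dE dE'.
have [z di dj] := gK (etrans (esym dE) dE').
rewrite dE'; apply/left_divides_mul2l/fmin; first by exists y.
rewrite dj; apply: left_divides_mul2l.
have [||w] := emin (C i j * z); [by exists x | by exists z|].
by rewrite eE -mulgA => /complemented_cancel ->; exists w.
Qed.

End ComplementedMonoid.

(** * Garside axioms from a central common multiple [D] *)

Section CentralGarside.
Local Open Scope group_scope.
Variables (M : monoidType) (lambda : M -> nat) (D : M).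
Hypothesis lambdaM : forall a b : M, lambda (a * b) = (lambda a + lambda b)%N.
Hypothesis lambda_eq0 : forall a : M, lambda a = 0%N -> a = 1.
Hypothesis cancel_l : forall a b c : M, a * b = a * c -> b = c.
Hypothesis lcm_ex : forall a b c : M, left_divides a c -> left_divides b c ->
  exists l, is_lcm (@left_divides M) a b l.
Hypothesis D_central : forall a : M, a * D = D * a.
Hypothesis D_multiple : forall a : M, exists k, left_divides a (D ^+ k).
Implicit Types a b c d e : M.

Lemma central_pow k a : a * D ^+ k = D ^+ k * a.
Proof. exact: (@commuteX M). Qed.

(** Here a (b a) = D^k a = a D^k, and [a] cancels. Complements in [D ^+ k] are thus two-sided. *)
Lemma central_cyclic k a b : a * b = D ^+ k -> b * a = D ^+ k.
Proof.
by move=> abE; apply: (@cancel_l a); rewrite mulgA abE -central_pow.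
Qed.

(** Multiplying on the right by a cofactor of [a] produces a central power, which moves to the left
    and cancels there. *)
Lemma central_cancel a b c : b * a = c * a -> b = c.
Proof.
have [k [a' kE]] := D_multiple a => /(congr1 (fun z => z * a')).
rewrite -!mulgA -kE !central_pow; exact: cancel_l.
Qed.

Lemma left_divides_pow k l a : (k <= l)%N ->
  left_divides a (D ^+ k) -> left_divides a (D ^+ l).
Proof.
move=> kl ak; apply: left_divides_trans ak _.
by exists (D ^+ (l - k)); rewrite -expgnDr subnKC.
Qed.

Lemma common_multiple a b :
  exists k, left_divides a (D ^+ k) /\ left_divides b (D ^+ k).
Proof.
have [k ak] := D_multiple a; have [l bl] := D_multiple b.
exists (maxn k l); split; [apply: left_divides_pow ak | apply: left_divides_pow bl].
  exact: leq_maxl.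
exact: leq_maxr.
Qed.

Lemma ex_left_lcm a b : exists c, is_lcm (@left_divides M) a b c.
Proof. by have [k [ak bk]] := common_multiple a b; apply: lcm_ex ak bk. Qed.

(* A common left-divisor of maximal weight is a gcd: its lcm with any other
   common divisor is again a common divisor, hence has the same weight. *)
Lemma ex_left_gcd a b : exists c, is_gcd (@left_divides M) a b c.
Proof.
pose P k := `[< exists d, [/\ left_divides d a, left_divides d b & lambda d = k] >].
have exP : exists k, P k.
  by exists (lambda 1); apply/asboolP; exists 1; split=> //; apply: left_divides1.
have ubP k : P k -> (k <= lambda a)%N.
  by move=> /asboolP[d [[u ->] _ <-]]; rewrite lambdaM leq_addr.
case: (ex_maxnP exP ubP) => k /asboolP[d [da db dk]] maxk.
exists d; split=> // e ea eb; have [l [dl el lmin]] := lcm_ex da ea.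
have [w lE] := dl; have Pl : P (lambda l).
  by apply/asboolP; exists l; split=> //; apply: lmin.
have := maxk _ Pl; rewrite lE lambdaM dk => lek.
have w1 : w = 1 by apply: lambda_eq0; lia.
by move: el; rewrite lE w1 mulg1.
Qed.

(** Complementation in [D ^+ k] reverses divisibility and exchanges the sides: c = u a corresponds
    to a' = c' u. *)
Lemma left_right_divides_dual k a a' c c' : a * a' = D ^+ k -> c * c' = D ^+ k ->
  right_divides a c <-> left_divides c' a'.
Proof.
move=> aE cE; split=> -[u uE]; exists u.
  apply: (@cancel_l a); rewrite aE mulgA; apply/esym/central_cyclic.
  by rewrite mulgA -uE.
apply: (@central_cancel c'); rewrite cE -mulgA; apply/esym.
by apply: central_cyclic; rewrite -mulgA -uE.
Qed.

Lemma right_left_pow k a : left_divides a (D ^+ k) <-> right_divides a (D ^+ k).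
Proof.
by split=> -[u uE]; exists u; apply/esym/central_cyclic/esym.
Qed.

(** The witness is the complement, in a common multiple [D ^+ k], of the right-lcm of the
    complements of [a] and [b]. *)
Lemma ex_right_gcd a b : exists c, is_gcd (@right_divides M) a b c.
Proof.
have [k [[a' aE] [b' bE]]] := common_multiple a b.
have [l [al bl lmin]] := ex_left_lcm a' b'.
have ak' : left_divides a' (D ^+ k).
  by exists a; apply/esym/central_cyclic/esym.
have bk' : left_divides b' (D ^+ k).
  by exists b; apply/esym/central_cyclic/esym.
have [c cE] := lmin _ ak' bk'; have {}cE := central_cyclic (esym cE).
exists c; split.
- exact/(left_right_divides_dual cE (esym aE)).
- exact/(left_right_divides_dual cE (esym bE)).
move=> d da db; have [d' dE] : left_divides d (D ^+ k).
  apply/right_left_pow; apply: right_divides_trans da _.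
  by apply/right_left_pow; exists a'.
apply/(left_right_divides_dual (esym dE) cE); apply: lmin.
  exact/(left_right_divides_dual (esym dE) (esym aE)).
exact/(left_right_divides_dual (esym dE) (esym bE)).
Qed.

(* The lcm is computed among the divisors of [D ^+ k]; the gcd with [D ^+ k]
   reduces an arbitrary common multiple to this case. *)
Lemma ex_right_lcm a b : exists c, is_lcm (@right_divides M) a b c.
Proof.
have [k [[a' aE] [b' bE]]] := common_multiple a b.
have [d [da db dmax]] := ex_left_gcd a' b'.
have [c cE] : right_divides d (D ^+ k).
  apply/right_left_pow; apply: left_divides_trans da _.
  by exists a; apply/esym/central_cyclic/esym.
exists c; split.
- exact/(left_right_divides_dual (esym aE) (esym cE)).
- exact/(left_right_divides_dual (esym bE) (esym cE)).
move=> e ae be; have [h [he [h' hE] hmax]] := ex_right_gcd e (D ^+ k).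
have {}hE := central_cyclic (esym hE).
apply: right_divides_trans he.
apply/(left_right_divides_dual (esym cE) hE); apply: dmax.
  apply/(left_right_divides_dual (esym aE) hE); apply: hmax => //.
  by apply/right_left_pow; exists a'.
apply/(left_right_divides_dual (esym bE) hE); apply: hmax => //.
by apply/right_left_pow; exists b'.
Qed.

Lemma central_garside : generates [set a | left_divides a D] ->
  finite_set [set a | left_divides a D] -> is_garside_monoid D.
Proof.
move=> D_gen D_fin; split=> //.
- exact: central_cancel.
- exists lambda; split=> [a b|a a1]; first by rewrite lambdaM.
  by move/lambda_eq0.
- by move=> a b; split; [apply: ex_left_lcm | apply: ex_left_gcd].
- by move=> a b; split; [apply: ex_right_lcm | apply: ex_right_gcd].
- by move=> a; rewrite -(expg1 D); apply: right_left_pow.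
Qed.

End CentralGarside.

(** * Homomorphisms out of presented monoids and groups *)

Section PresentedMonoidLift.
Local Open Scope group_scope.
Variables (I : choiceType) (R : seq I -> seq I -> Prop).

(** A general monoid law covers both products in a monoid and sums of weights. *)
Lemma pcong_big (T : Type) (idx : T) (op : Monoid.law idx) (f : I -> T) :
  (forall l r, R l r -> \big[op/idx]_(i <- l) f i = \big[op/idx]_(i <- r) f i) ->
  forall u v, pcong R u v ->
  \big[op/idx]_(i <- u) f i = \big[op/idx]_(i <- v) f i.
Proof.
move=> fR u v; elim=> {u v} [u v l r lr|//|u v _ -> //|v u w _ -> _ -> //].
by rewrite !big_cat /= (fR _ _ lr).
Qed.

Local Notation PM := (presented_monoid R).

Lemma word_class_nil : word_class R [::] = 1.
Proof. by []. Qed.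

Lemma word_class_cons i u : word_class R (i :: u) = pgen R i * word_class R u.
Proof. by rewrite [RHS]word_class_cat. Qed.

Lemma word_class_catM u v : word_class R (u ++ v) = word_class R u * word_class R v.
Proof. by rewrite [RHS]word_class_cat. Qed.

Lemma word_class_prod u : word_class R u = \prod_(i <- u) pgen R i.
Proof.
by elim: u => [|i u IH]; rewrite ?big_nil // big_cons word_class_cons IH.
Qed.

Lemma word_class_nseq k i : word_class R (nseq k i) = (pgen R i : PM) ^+ k.
Proof. by elim: k => [//|k IH]; rewrite expgS -IH -word_class_cons. Qed.

Lemma pgenP (a : PM) : a = 1 \/ exists i b, a = pgen R i * b.
Proof.
rewrite -(word_reprK a); case: (word_repr a) => [|i u]; first by left.
by right; exists i, (word_class R u); rewrite word_class_cons.
Qed.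

Variables (N : monoidType) (f : I -> N).
Hypothesis fR : forall l r, R l r -> \prod_(i <- l) f i = \prod_(i <- r) f i.

Definition presented_lift (a : PM) : N := \prod_(i <- word_repr a) f i.

Lemma presented_lift_class u : presented_lift (word_class R u) = \prod_(i <- u) f i.
Proof. exact/(pcong_big fR)/word_classK. Qed.

Lemma presented_liftM : {morph presented_lift : a b / a * b}.
Proof.
move=> a b; rewrite -(word_reprK a) -(word_reprK b) -word_class_catM.
by rewrite !presented_lift_class big_cat.
Qed.

Lemma presented_lift1 : presented_lift 1 = 1.
Proof. by rewrite -word_class_nil presented_lift_class big_nil. Qed.

Lemma presented_lift_gen i : presented_lift (pgen R i) = f i.
Proof. by rewrite presented_lift_class big_seq1. Qed.

Lemma presented_liftX a k : presented_lift (a ^+ k) = presented_lift a ^+ k.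
Proof.
by elim: k => [|k IH]; rewrite ?presented_lift1 // !expgS presented_liftM IH.
Qed.

End PresentedMonoidLift.

Lemma pgen_inv (I : choiceType) (R : seq (I * bool) -> seq (I * bool) -> Prop) i b :
  ((pgen (group_rel R) (i, b) : presented_group R)^-1 =
   pgen (group_rel R) (i, ~~ b))%g.
Proof.
apply: mulg1_eq; rewrite [LHS]word_class_cat; apply/word_classP.
exact: (@pcong_rel _ _ [::] [::] _ _ (group_rel_inv R i b)).
Qed.

Section GroupLift.
Local Open Scope group_scope.
Variables (I : choiceType) (R : seq (I * bool) -> seq (I * bool) -> Prop).
Variables (H : groupType) (f : I -> H).

Definition letter_lift (x : I * bool) : H := if x.2 then (f x.1)^-1 else f x.1.

Hypothesis fR : forall l r, R l r ->
  \prod_(x <- l) letter_lift x = \prod_(x <- r) letter_lift x.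

(** The relations for inverses hold in every group, so only [R] has to be checked. *)
Lemma group_rel_lift l r : group_rel R l r ->
  \prod_(x <- l) letter_lift x = \prod_(x <- r) letter_lift x.
Proof.
case=> {l r} [l r|i b]; first exact: fR.
by rewrite big_cons big_seq1 big_nil; case: b; rewrite /letter_lift /= ?mulVg ?mulgV.
Qed.

End GroupLift.

(** Over a finite alphabet few words are short; this will bound the divisors of Delta. *)
Lemma finite_short_words (T : finType) (R : seq T -> seq T -> Prop) k :
  finite_set [set a : presented_monoid R | (size (word_repr a) <= k)%N].
Proof.
apply: (@sub_finite_set _ _
  [set word_class R (val s) | s in [set: k.-bseq T]]).
  by move=> a /= ak; exists (Bseq ak); rewrite //= word_reprK.
by apply: finite_image; apply: finite_finset.
Qed.

(** * Arithmetic of the residues k_i and of the exponents alpha *)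

Section TorusArithmetic.
Variables n m : nat.
Hypotheses (n_ge2 : 2 <= n) (n_lt_m : n < m) (nm_coprime : coprime n m).
Local Notation q := (m %/ n).
Local Notation r := (m %% n).
Local Notation k_ := (kres n m).

(* The exponent with rho_i = x^i y^(- alpha i) in the torus knot group: it is
   the largest one for which the weight i m - n (alpha i) is positive. *)
Definition alpha (i : nat) : nat := (i * m).-1 %/ n.

Lemma alphaE i : 0 < i -> i * m = alpha i * n + k_ i.
Proof.
move=> i_gt0; have n_gt0 : 0 < n by lia.
have /andP[k0 kn] := kres_bounds m i n_gt0.
have im_gt : k_ i <= i * m by nia.
have /dvdnP[d dE] : n %| i * m - k_ i.
  by rewrite -eqn_mod_dvd // eq_sym kres_mod modnMmr.
have imE : i * m = d * n + k_ i by lia.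
(* As k_i lies in 1..n, subtracting 1 gives a Euclidean division. *)
rewrite {1}imE /alpha (_ : (i * m).-1 = d * n + (k_ i).-1); last by lia.
by rewrite divnMDl // divn_small ?addn0 //; lia.
Qed.

Lemma leq_alpha i j : i <= j -> alpha i <= alpha j.
Proof.
by move=> ij; apply/leq_div2r; rewrite -!subn1 leq_sub2r // leq_mul2r ij orbT.
Qed.

(** Coprimality and n >= 2 exclude n | m, where the residue would be n instead of r. *)
Lemma kres1 : k_ 1 = r.
Proof.
have n_gt0 : 0 < n by lia.
rewrite /kres mul1n modn_mod ifN // /dvdn modn_mod -/(n %| m).
by apply/negP => /gcdn_idPl gE; move: nm_coprime; rewrite /coprime gE; lia.
Qed.

Lemma kresn : k_ n = n.
Proof. by rewrite /kres dvdn_mulr. Qed.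

Lemma alpha1 : alpha 1 = q.
Proof.
have n_gt0 : 0 < n by lia.
apply/eqP; rewrite -(eqn_pmul2r n_gt0) -(eqn_add2r r) -divn_eq.
by rewrite -kres1 -alphaE // mul1n.
Qed.

Lemma alphan : alpha n = m.-1.
Proof.
have n_gt0 : 0 < n by lia.
by have := alphaE n_gt0; rewrite kresn; nia.
Qed.

Lemma alphaS i : 0 < i -> alpha i.+1 = alpha i + (q + Dexp n m i).
Proof.
move=> i_gt0; have n_gt0 : 0 < n by lia.
have := kresS m i n_gt0; rewrite -DexpE // => kE.
have := alphaE i_gt0; have := alphaE (ltn0Sn i).
have := divn_eq m n; move: (Dexp n m i) kE => d kE; nia.
Qed.

(** The defining relations are homogeneous when rho_i has weight k_i. *)
Lemma torus_rel_weight i :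
  k_ 1 + (q * k_ n + k_ i) = k_ i.+1 + (q + Dexp n m i) * k_ n.
Proof.
have n_gt0 : 0 < n by lia.
by have := kresS m i n_gt0; rewrite -DexpE // kres1 kresn; lia.
Qed.

End TorusArithmetic.

(** The ordinal [l] stands for rho_(l+1), whence the shifts [l.+1] below. *)
Lemma rhoS n (l : 'I_n.-1.+1) : rho n l.+1 = l.
Proof. by rewrite /rho inord_val. Qed.

Lemma rho_val n i : 0 < i <= n -> (rho n i).+1 = i.
Proof. by move=> i_range; rewrite /rho inordK; lia. Qed.

Lemma ord_range n (l : 'I_n.-1.+1) : 2 <= n -> 0 < l.+1 <= n.
Proof. by have := ltn_ord l; lia. Qed.

(** * Powers of x and centrality of Delta *)

Section TorusMonoid.
Local Open Scope group_scope.
Variables n m : nat.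
Hypotheses (n_ge2 : (2 <= n)%N) (n_lt_m : (n < m)%N) (nm_coprime : coprime n m).
Local Notation q := (m %/ n)%N.
Local Notation rel := (@torus_monoid_rel n m).
Local Notation M := (torus_monoid n m).
Local Notation alpha := (alpha n m).
Implicit Types (a b c d : M) (i j k : nat).

Lemma kres_gt0 i : (0 < kres n m i)%N.
Proof. by have /andP[] := kres_bounds m i (ltnW n_ge2). Qed.

Definition rhog i : M := pgen rel (rho n i).
Local Notation y := (rhog n).
Definition torus_x : M := rhog 1 * y ^+ q.
Local Notation x := torus_x.
Local Notation inr i := (0 < i <= n)%N.

Lemma torus_relE i : (1 <= i <= n.-1)%N ->
  x * rhog i = rhog i.+1 * y ^+ (q + Dexp n m i).
Proof.
move=> i_range; have := @pcong_rel _ rel [::] [::] _ _ (@TorusMonoidRel n m i i_range).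
move/word_classP; rewrite /= !cats0 !word_class_cons word_class_catM.
by rewrite !word_class_nseq mulgA.
Qed.

(** Each factor x raises the index by one and releases y^(q + D(i)), the increment of alpha. *)
Lemma torus_x_pow i : inr i -> x ^+ i = rhog i * y ^+ alpha i.
Proof.
case: i => // i; elim: i => [|i IH] i_range; first by rewrite alpha1.
rewrite expgS IH; last by lia.
rewrite mulgA torus_relE; last by lia.
by rewrite -mulgA -expgnDr [alpha i.+2]alphaS // addnC.
Qed.

Lemma torus_x_pow_rho i j : (0 < j)%N -> (i + j <= n)%N ->
  x ^+ i * rhog j = rhog (i + j) * y ^+ (alpha (i + j) - alpha j).
Proof.
move=> j_gt0; elim: i => [|i IH] ij; first by rewrite subnn !gsimp.
rewrite expgS -mulgA IH; last by lia.
rewrite mulgA torus_relE; last by lia.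
rewrite -mulgA -expgnDr addSn [alpha (i + j).+1]alphaS //; last by lia.
by rewrite addnBA ?leq_alpha ?leq_addl // [(alpha _ + _)%N in RHS]addnC.
Qed.

Lemma rho_shift i j : (0 < i)%N -> (0 < j)%N -> (i + j <= n)%N ->
  rhog i * (y ^+ alpha i * rhog j) = rhog (i + j) * y ^+ (alpha (i + j) - alpha j).
Proof.
by move=> i0 j0 ij; rewrite mulgA -torus_x_pow ?torus_x_pow_rho //; lia.
Qed.

Lemma torus_x_pow_n : x ^+ n = y ^+ m.
Proof.
rewrite torus_x_pow; last by lia.
by rewrite alphan // -expgS prednK //; lia.
Qed.

Lemma torus_DeltaE : torus_Delta n m = y ^+ m.
Proof. by []. Qed.

(** Write Delta = x^i x^(n-i): the right factor carries rho_i to y^(m - alpha i), and x^i = rho_i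
    y^(alpha i) completes this to rho_i y^m. *)
Lemma rho_Delta i : inr i -> rhog i * torus_Delta n m = torus_Delta n m * rhog i.
Proof.
move=> i_range; rewrite torus_DeltaE -{2}torus_x_pow_n.
have -> : x ^+ n = x ^+ i * x ^+ (n - i) by rewrite -expgnDr subnKC //; lia.
rewrite -mulgA torus_x_pow_rho; [|lia..].
rewrite subnK ?torus_x_pow -?mulgA -?expgS -?expgnDr //; last by lia.
have := @leq_alpha n m i n; rewrite alphan // => le_alpha.
by congr (_ * _ ^+ _); lia.
Qed.

Lemma torus_genE l : pgen rel l = rhog l.+1.
Proof. by rewrite /rhog rhoS. Qed.

Lemma Delta_central a : a * torus_Delta n m = torus_Delta n m * a.
Proof.
rewrite -(word_reprK a); elim: (word_repr a) => [|l u IH].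
  by rewrite word_class_nil mulg1 mul1g.
rewrite word_class_cons torus_genE -mulgA IH mulgA rho_Delta ?mulgA //.
exact: ord_range.
Qed.

(** * The weight and the complements of the generators *)

Definition word_weight (u : seq 'I_n.-1.+1) : nat := \sum_(l <- u) kres n m l.+1.
Definition weight a : nat := word_weight (word_repr a).
Arguments weight a%_g.

Lemma word_weight_pcong u v : pcong rel u v -> word_weight u = word_weight v.
Proof.
rewrite /word_weight; move: u v; apply: pcong_big => _ _ [i i_range].
rewrite !big_cons big_cat !big_nseq big_seq1 !rho_val; [|lia..].
by rewrite /= !iter_addn_0 ![(kres n m n * _)%N]mulnC; apply: torus_rel_weight.
Qed.

Lemma weight_class u : weight (word_class rel u) = word_weight u.
Proof. exact/word_weight_pcong/word_classK. Qed.

Lemma weightM a b : weight (a * b) = (weight a + weight b)%N.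
Proof.
rewrite -(word_reprK a) -(word_reprK b) -word_class_catM !weight_class.
exact: big_cat.
Qed.

Lemma weight_mulr_lt N a b : (weight (a * b) < N)%N -> (weight b < N)%N.
Proof. by rewrite weightM; apply/leq_ltn_trans/leq_addl. Qed.

Lemma weight_rho i : inr i -> weight (rhog i) = kres n m i.
Proof.
by move=> i_range; rewrite weight_class /word_weight big_seq1 rho_val.
Qed.

Lemma weight_rho_gt0 i : inr i -> (0 < weight (rhog i))%N.
Proof.
move=> i_range; rewrite weight_rho //.
exact: kres_gt0.
Qed.

Lemma size_weight u : (size u <= word_weight u)%N.
Proof.
rewrite -sum1_size; apply: leq_sum => l _.
exact: kres_gt0.
Qed.

(* [rho_i * rho_compl i j] is the right-lcm of rho_i and rho_j. *)
Definition rho_compl i j : M :=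
  if i == j then 1
  else if (i < j)%N then y ^+ alpha i * rhog (j - i)
  else y ^+ (alpha i - alpha (i - j)).

Lemma rho_complii i : rho_compl i i = 1.
Proof. by rewrite /rho_compl eqxx. Qed.

Lemma rho_compl_lt i j : (i < j)%N -> rho_compl i j = y ^+ alpha i * rhog (j - i).
Proof. by rewrite /rho_compl => ij; rewrite ltn_eqF ij. Qed.

Lemma rho_compl_gt i j : (j < i)%N -> rho_compl i j = y ^+ (alpha i - alpha (i - j)).
Proof. by rewrite /rho_compl => ij; rewrite gtn_eqF // ltnNge ltnW. Qed.

Lemma rho_complC i j : inr i -> inr j ->
  rhog i * rho_compl i j = rhog j * rho_compl j i.
Proof.
wlog ij : i j / (i <= j)%N => [IH|] i_range j_range.
  by case: (leqP i j) => [|/ltnW] ij; [|apply/esym]; apply: IH.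
move: ij; rewrite leq_eqVlt => /predU1P[->//|ij].
rewrite rho_compl_lt // rho_compl_gt // rho_shift ?subnKC //; lia.
Qed.

(** * Factoring equalities rho_i a = rho_j b through the complements *)

Definition joint_mult i j a b :=
  exists2 t, a = rho_compl i j * t & b = rho_compl j i * t.

Lemma joint_mult_sym i j a b : joint_mult i j a b -> joint_mult j i b a.
Proof. by move=> [t aE bE]; exists t. Qed.

(* Given [c] with [rho_i a = rho_k c = rho_j b], the weight of [c] is smaller, so
   equalities between its factorizations can be cancelled by induction: the cube
   condition for [i], [j], [k] is checked in this way in each relative order. *)
Section Cube.
Variable N : nat.
Hypothesis IH : forall i j a b, inr i -> inr j -> (weight (rhog i * a) < N)%N ->
  rhog i * a = rhog j * b -> joint_mult i j a b.

Lemma rho_cancel_lt i a b : inr i -> (weight (rhog i * a) < N)%N ->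
  rhog i * a = rhog i * b -> a = b.
Proof.
by move=> i_range wa /(IH i_range i_range wa)[t]; rewrite rho_complii => -> ->.
Qed.

Lemma y_pow_cancel_lt e a b : (weight (y ^+ e * a) < N)%N ->
  y ^+ e * a = y ^+ e * b -> a = b.
Proof.
elim: e => [|e IHe]; first by rewrite !mul1g.
rewrite expgS -!mulgA => wa E; apply: IHe; first exact: weight_mulr_lt wa.
by apply: rho_cancel_lt wa E; lia.
Qed.

Lemma joint_mult_trans_lt k i j c a b : inr i -> inr j -> inr k -> (i < j)%N ->
  (weight c < N)%N -> joint_mult i k a c -> joint_mult k j c b -> joint_mult i j a b.
Proof.
move=> i_range j_range k_range ij wc [s aE cE] [t cE' bE].
have [ik|ki|iE] := ltngtP i k; last first.
- by subst k; exists t; rewrite // -cE' aE cE.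
(* k < i < j: cancelling y^(alpha k) in [c] leaves rho_(i-k) s = rho_(j-k) t of weight below [N],
   with the same index difference. *)
- have kj : (k < j)%N by apply: ltn_trans ij.
  move: aE cE cE' bE.
  rewrite (rho_compl_gt ki) (rho_compl_lt ki) (rho_compl_lt kj) (rho_compl_gt kj).
  move=> aE cE cE' bE.
  have E : rhog (i - k) * s = rhog (j - k) * t.
    by apply: (@y_pow_cancel_lt (alpha k)); rewrite !mulgA -cE -?cE'.
  have [||||p] := @IH (i - k)%N (j - k)%N s t; [lia|lia| |exact: E|].
    by move: wc; rewrite cE -mulgA; apply: weight_mulr_lt.
  rewrite rho_compl_lt ?rho_compl_gt; [|lia..].
  rewrite (_ : j - k - (i - k) = j - i)%N; last by lia.
  move=> sE tE; exists p.
    rewrite rho_compl_lt // aE sE !mulgA -expgnDr subnK //.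
    by apply: leq_alpha; lia.
  rewrite rho_compl_gt // bE tE mulgA -expgnDr; congr (_ ^+ _ * _).
  have := @leq_alpha n m (j - k) j; have := @leq_alpha n m (j - i) (j - k); lia.
have [jk|kj|jE] := ltngtP j k; last first.
- by subst k; exists s; rewrite // -cE bE cE'.
(* i < k < j: comparing the two forms of [c] gives s, and [rho_shift] turns rho_(k-i) s into a
   multiple of rho_(j-i). *)
- move: aE cE cE' bE.
  rewrite (rho_compl_gt ik) (rho_compl_lt ik) (rho_compl_lt kj) (rho_compl_gt kj).
  move=> aE cE cE' bE.
  have l1 := @leq_alpha n m (k - i) k; have l2 := @leq_alpha n m (j - k) (j - i).
  have l3 := @leq_alpha n m (j - i) j.
  have sE : s = y ^+ alpha (k - i) * rhog (j - k) * t.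
    apply: (@y_pow_cancel_lt (alpha k - alpha (k - i))); rewrite -?cE // cE'.
    by rewrite !mulgA -expgnDr subnK //; lia.
  exists (y ^+ (alpha (j - i) - alpha (j - k)) * t).
    rewrite aE sE rho_compl_lt // -!mulgA; congr (_ * _).
    rewrite !mulgA -(mulgA (rhog _)) rho_shift; [|lia..].
    by rewrite (_ : k - i + (j - k) = j - i)%N //; lia.
  rewrite bE rho_compl_gt // mulgA -expgnDr; congr (_ ^+ _ * _); lia.
(* i < j < k: both forms of [c] start with powers of y, and [rho_shift] is read from right to
   left. *)
move: aE cE cE' bE.
rewrite (rho_compl_gt ik) (rho_compl_lt ik) (rho_compl_gt jk) (rho_compl_lt jk).
move=> aE cE cE' bE.
have l1 := @leq_alpha n m (k - i) k; have l2 := @leq_alpha n m (k - j) (k - i).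
have l3 := @leq_alpha n m (j - i) j.
have sE : s = y ^+ (alpha (k - i) - alpha (k - j)) * t.
  apply: (@y_pow_cancel_lt (alpha k - alpha (k - i))); rewrite -?cE // cE'.
  by rewrite mulgA -expgnDr; congr (_ ^+ _ * _); lia.
exists (y ^+ alpha (j - i) * rhog (k - j) * t).
  rewrite aE sE rho_compl_lt // -!mulgA; congr (_ * _).
  rewrite !mulgA -(mulgA (rhog (j - i))) rho_shift; [|lia..].
  by rewrite (_ : j - i + (k - j) = k - i)%N //; lia.
rewrite bE rho_compl_gt // !mulgA -expgnDr; congr (_ ^+ _ * _ * _); lia.
Qed.

(** The case j < i follows by symmetry; for i = j the claim is a = b, obtained by cancelling
    [rho_compl k i] in [c]. *)
Lemma joint_mult_trans k i j c a b : inr i -> inr j -> inr k ->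
  (weight c < N)%N -> joint_mult i k a c -> joint_mult k j c b -> joint_mult i j a b.
Proof.
move=> i_range j_range k_range wc ac cb.
have [ij|ji|ijE] := ltngtP i j; first by apply: joint_mult_trans_lt ac cb.
  apply: joint_mult_sym.
  by apply: joint_mult_trans_lt (joint_mult_sym cb) (joint_mult_sym ac).
subst j; have [s aE cE] := ac; have [t cE' bE] := cb.
exists a; rewrite rho_complii mul1g // aE bE; congr (_ * _).
move: wc; rewrite cE' in cE *; have [ik|ki|ikE] := ltngtP i k; last first.
- by subst k; rewrite rho_complii !mul1g in cE *.
- rewrite rho_compl_lt // in cE * => wc.
  apply: (@rho_cancel_lt (i - k)); [lia| |].
    by move: wc; rewrite -mulgA; apply: weight_mulr_lt.
  by apply: (@y_pow_cancel_lt (alpha k)); rewrite !mulgA.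
- by rewrite rho_compl_gt // in cE * => /y_pow_cancel_lt; apply.
Qed.

End Cube.

Lemma rho_joint_mult i j a b : inr i -> inr j ->
  rhog i * a = rhog j * b -> joint_mult i j a b.
Proof.
have [N leN] := ubnP (weight (rhog i * a)).
elim: N => // N IH in i j a b leN *; move=> i_range j_range.
have {}IH i' j' a' b' : inr i' -> inr j' -> (weight (rhog i' * a') < N)%N ->
    rhog i' * a' = rhog j' * b' -> joint_mult i' j' a' b'.
  by move=> ? ? ?; apply: IH.
(* Induction on the derivation of the congruence. The bound [<= N] on whole words becomes [< N] for
   tails, as letters have positive weight. *)
have head_match u v : pcong rel u v -> (word_weight u <= N)%N ->
    match u, v with
    | i :: u', j :: v' => joint_mult i.+1 j.+1 (word_class rel u') (word_class rel v')
    | [::], [::] => True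
    | _, _ => False
    end.
  elim=> {u v} [[|l u] v l0 r0 lr|[|l u]|u v uv IHuv|v u w uv IHuv vw IHvw] leuN.
  (* A relation at the head: its two sides are the complement square of rho_1 and rho_(k+1). *)
  - case: lr => k k_range; rewrite /= !rho_val; [|lia..].
    have k_gt1 : (1 < k.+1)%N by lia.
    exists (word_class rel v).
      rewrite rho_compl_lt // subSS subn0 alpha1 // !word_class_catM.
      by rewrite word_class_nseq.
    rewrite rho_compl_gt // subSS subn0 alphaS // addKn.
    by rewrite word_class_catM word_class_nseq.
  (* A relation past the first letter leaves that letter unchanged. *)
  - exists (word_class rel (u ++ r0 ++ v)); rewrite rho_complii mul1g //.
    by apply/word_classP/pcong_rel.
  - by [].
  - by exists (word_class rel u); rewrite rho_complii mul1g.
  - rewrite -(word_weight_pcong uv) in leuN; move/(_ leuN): IHuv.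
    by case: u v {uv leuN} => [|l u] [|l' v] //; apply: joint_mult_sym.
  (* Transitivity is the cube condition, with the tail of the middle word as [c]. *)
  - move/(_ leuN): IHuv; rewrite (word_weight_pcong uv) in leuN.
    move/(_ leuN): IHvw.
    case: u v w {uv vw} leuN => [|l u] [|l' v] [|l'' w] // leN' vw uv.
    apply: (joint_mult_trans IH _ _ _ _ uv vw); [exact: ord_range..|].
    rewrite weight_class; move: leN'; rewrite /word_weight big_cons.
    by have := kres_gt0 l'.+1; lia.
have := @head_match (rho n i :: word_repr a) (rho n j :: word_repr b).
rewrite !rho_val // !word_reprK => E rE; apply: E.
  by apply/word_classP; rewrite !word_class_cons !word_reprK.
by move: leN; rewrite -weight_class word_class_cons word_reprK.
Qed.

End TorusMonoid.

(** * The Garside structure on the torus monoid *)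

Section TorusGarside.
Local Open Scope group_scope.
Variables n m : nat.
Hypotheses (n_ge2 : (2 <= n)%N) (n_lt_m : (n < m)%N) (nm_coprime : coprime n m).
Local Notation rel := (@torus_monoid_rel n m).
Local Notation M := (torus_monoid n m).
Local Notation Delta := (torus_Delta n m).
Local Notation alpha := (alpha n m).
Local Notation rhog := (@rhog n m).
Local Notation x := (torus_x n m).
Local Notation y := (rhog n).
Implicit Types (a b c d : M) (i j k : nat) (l : 'I_n.-1.+1).

Lemma weight_gen_gt0 l : (0 < weight (pgen rel l : M))%N.
Proof. by rewrite torus_genE; apply: weight_rho_gt0 (ord_range l n_ge2). Qed.

Lemma gen_complC l l' :
  pgen rel l * rho_compl n m l.+1 l'.+1 = pgen rel l' * rho_compl n m l'.+1 l.+1.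
Proof. by rewrite !torus_genE; apply: rho_complC; rewrite ?ord_range. Qed.

Lemma gen_joint_mult l l' a b : pgen rel l * a = pgen rel l' * b ->
  exists2 t, a = rho_compl n m l.+1 l'.+1 * t & b = rho_compl n m l'.+1 l.+1 * t.
Proof. by rewrite !torus_genE; apply: rho_joint_mult; rewrite ?ord_range. Qed.

Lemma weight_eq0 a : weight a = 0%N -> a = 1.
Proof.
exact: (lambda_eq0 (@weightM n m n_ge2 n_lt_m nm_coprime) weight_gen_gt0
  (@pgenP _ rel)).
Qed.

Lemma torus_cancel_l a b c : a * b = a * c -> b = c.
Proof.
exact: (complemented_cancel (@weightM n m n_ge2 n_lt_m nm_coprime)
  weight_gen_gt0 (@pgenP _ rel) gen_joint_mult (fun l => rho_complii n m l.+1)).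
Qed.

Lemma torus_lcm a b c : left_divides a c -> left_divides b c ->
  exists d, is_lcm (@left_divides M) a b d.
Proof.
exact: (complemented_lcm (@weightM n m n_ge2 n_lt_m nm_coprime) weight_gen_gt0
  (@pgenP _ rel) gen_complC gen_joint_mult (fun l => rho_complii n m l.+1)).
Qed.

(** Delta = x^i x^(n-i), and x^i starts with rho_i. *)
Lemma rho_divides_Delta i : (0 < i <= n)%N -> left_divides (rhog i) Delta.
Proof.
move=> i_range; exists (y ^+ alpha i * x ^+ (n - i)).
rewrite torus_DeltaE -torus_x_pow_n // mulgA -torus_x_pow // -expgnDr subnKC //.
by lia.
Qed.

(** Letters divide Delta and Delta is central, so a word of length k divides Delta^k. *)
Lemma torus_Delta_multiple a : exists k, left_divides a (Delta ^+ k).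
Proof.
rewrite -(word_reprK a); elim: (word_repr a) => [|l u [k [b kE]]].
  by exists 0%N; apply: left_divides_refl.
have [c cE] := rho_divides_Delta (ord_range l n_ge2).
exists k.+1; exists (b * c); rewrite word_class_cons torus_genE.
rewrite expgSr [X in _ * X = _]cE !mulgA -(mulgA (rhog _)) -kE.
by rewrite (central_pow (Delta_central n_ge2 n_lt_m nm_coprime)).
Qed.

Lemma torus_garside : is_garside_monoid Delta.
Proof.
apply: (central_garside (@weightM n m n_ge2 n_lt_m nm_coprime) weight_eq0
  torus_cancel_l torus_lcm (Delta_central n_ge2 n_lt_m nm_coprime)
  torus_Delta_multiple).
  move=> a; exists [seq pgen rel l | l <- word_repr a].
    move=> _ /mapP[l _ ->] /=.
    by rewrite torus_genE; apply: rho_divides_Delta (ord_range l n_ge2).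
  by rewrite big_map -word_class_prod word_reprK.
(* A divisor of Delta weighs at most as much as Delta, and weight bounds word length. *)
apply: sub_finite_set (@finite_short_words _ rel (weight Delta)) => a /= [b DE].
apply: leq_trans (size_weight m n_ge2 _) _.
by rewrite DE weightM // leq_addr.
Qed.

Lemma torus_cancel_r a b c : b * a = c * a -> b = c.
Proof. exact: (garside_cancel_right torus_garside). Qed.

End TorusGarside.

(** * Homomorphisms given by a pair s, t with s^n = t^m in a group *)

Definition knot_gen n m (b : bool) : torus_knot_group n m :=
  pgen (group_rel (@torus_knot_group_rel n m)) (b, false).

Section TorusEmbedding.
Local Open Scope group_scope.
Variables n m : nat.
Hypotheses (n_ge2 : (2 <= n)%N) (n_lt_m : (n < m)%N) (nm_coprime : coprime n m).
Local Notation M := (torus_monoid n m).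
Local Notation alpha := (alpha n m).
Variables (H : groupType) (s t : H).
Hypothesis st : s ^+ n = t ^+ m.

Definition rho_image (i : nat) : H := s ^+ i / t ^+ alpha i.

Lemma rho_image1 : rho_image 1 * t ^+ (m %/ n) = s.
Proof. by rewrite /rho_image alpha1 // mulgVK. Qed.

Lemma rho_imagen : rho_image n = t.
Proof.
rewrite /rho_image alphan // st; apply/eqP; rewrite divg_eq -expgS prednK //.
by lia.
Qed.

Definition torus_embed : M -> H :=
  presented_lift (fun l : 'I_n.-1.+1 => rho_image l.+1).

(** Since rho_1 rho_n^q maps to s and rho_n to t, the relation reduces to the recursion [alphaS] for
    the exponents of t. *)
Lemma torus_embed_rel u v : @torus_monoid_rel n m u v ->
  \prod_(l <- u) rho_image (nat_of_ord l).+1 =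
  \prod_(l <- v) rho_image (nat_of_ord l).+1.
Proof.
case=> i i_range; rewrite !big_cons big_cat !big_nseq big_seq1 !iter_mulg_1.
rewrite !rho_val; [|lia..].
rewrite rho_imagen /= mulgA rho_image1 /rho_image mulgA -expgS alphaS //; last by lia.
rewrite [(alpha i + _)%N]addnC [_ ^+ (_ + alpha i)]expgnDr invgM mulgA.
by rewrite mulgVK.
Qed.

Lemma torus_embedM : {morph torus_embed : a b / a * b}.
Proof. exact: presented_liftM torus_embed_rel. Qed.

Lemma torus_embed1 : torus_embed 1 = 1.
Proof. exact: presented_lift1 torus_embed_rel. Qed.

Lemma torus_embedX a k : torus_embed (a ^+ k) = torus_embed a ^+ k.
Proof. exact: presented_liftX torus_embed_rel a k. Qed.

Lemma torus_embed_rho i : (0 < i <= n)%N -> torus_embed (rhog n m i) = rho_image i.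
Proof.
move=> i_range; rewrite /torus_embed /rhog.
by rewrite (presented_lift_gen torus_embed_rel) rho_val.
Qed.

Lemma torus_embed_y : torus_embed (rhog n m n) = t.
Proof. by rewrite torus_embed_rho ?rho_imagen //; lia. Qed.

Lemma torus_embed_x : torus_embed (torus_x n m) = s.
Proof.
rewrite torus_embedM torus_embedX torus_embed_y torus_embed_rho ?rho_image1 //.
by lia.
Qed.

Definition knot_gen_image (b : bool) : H := if b then s else t.

Definition knot_lift : torus_knot_group n m -> H :=
  presented_lift (letter_lift knot_gen_image).

Lemma knot_lift_rel u v : group_rel (@torus_knot_group_rel n m) u v ->
  \prod_(z <- u) letter_lift knot_gen_image z =
  \prod_(z <- v) letter_lift knot_gen_image z.
Proof.
apply: group_rel_lift => _ _ []; rewrite !big_nseq !iter_mulg_1; exact: st.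
Qed.

Lemma knot_liftM : {morph knot_lift : a b / a * b}.
Proof. exact: presented_liftM knot_lift_rel. Qed.

Lemma knot_lift1 : knot_lift 1 = 1.
Proof. exact: presented_lift1 knot_lift_rel. Qed.

Lemma knot_lift_gen b : knot_lift (knot_gen n m b) = knot_gen_image b.
Proof. exact: (presented_lift_gen knot_lift_rel). Qed.

Lemma knot_liftX a k : knot_lift (a ^+ k) = knot_lift a ^+ k.
Proof. exact: presented_liftX knot_lift_rel a k. Qed.

Lemma knot_liftV a : knot_lift a^-1 = (knot_lift a)^-1.
Proof. by apply/esym/mulg1_eq; rewrite -knot_liftM mulgV knot_lift1. Qed.

End TorusEmbedding.

(** * The knot group as group of fractions *)

Section TorusKnotGroup.
Local Open Scope group_scope.
Variables n m : nat.
Hypotheses (n_ge2 : (2 <= n)%N) (n_lt_m : (n < m)%N) (nm_coprime : coprime n m).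
Local Notation M := (torus_monoid n m).
Local Notation Delta := (torus_Delta n m).
Local Notation alpha := (alpha n m).
Local Notation x := (torus_x n m).
Local Notation y := (rhog n m n).
Local Notation knot_gen := (@knot_gen n m).
Local Notation grel := (group_rel (@torus_knot_group_rel n m)).
Local Notation T := (torus_knot_group n m).

Lemma knot_gen_rel : knot_gen true ^+ n = knot_gen false ^+ m.
Proof.
rewrite -!word_class_nseq; apply/word_classP.
have := @pcong_rel _ grel [::] [::] _ _ (group_rel_rel (TorusKnotGroupRel n m)).
by rewrite /= !cats0.
Qed.

(* A group word equals [numer u * Delta ^- (denom u)]: the inverses of x and y
   are x^(n-1) Delta^-1 and y^(m-1) Delta^-1. *)
Definition numer (u : seq (bool * bool)) : M :=
  \prod_(z <- u) match z with
    | (true, false) => x | (true, true) => x ^+ n.-1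
    | (false, false) => y | (false, true) => y ^+ m.-1
    end.
Definition denom (u : seq (bool * bool)) : nat := count snd u.

Lemma numer_cat u v : numer (u ++ v) = numer u * numer v.
Proof. exact: big_cat. Qed.

Lemma numer_nseq k z : numer (nseq k z) = numer [:: z] ^+ k.
Proof. by rewrite /numer big_nseq big_seq1 iter_mulg_1. Qed.

Lemma x_powE : x ^+ n = Delta.
Proof. exact: torus_x_pow_n. Qed.

Lemma numer_inv b c : numer [:: (b, c); (b, ~~ c)] = Delta.
Proof.
rewrite /numer big_cons big_seq1.
case: b c => [] [] /=; rewrite -?expgS -?expgSr prednK ?x_powE //; lia.
Qed.

(** Equality of fractions with central denominators, cross-multiplied so that it takes place in the
    monoid itself. *)
Lemma numer_pcong u v : pcong grel u v ->
  numer u * Delta ^+ denom v = numer v * Delta ^+ denom u.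
Proof.
have Dpow k (a : M) : a * Delta ^+ k = Delta ^+ k * a.
  exact: central_pow (Delta_central n_ge2 n_lt_m nm_coprime) k a.
elim=> {u v} [u v l0 r0 lr|//|//|v u w _ IHuv _ IHvw].
  rewrite !numer_cat /denom !count_cat.
  have {lr}E : numer l0 * Delta ^+ denom r0 = numer r0 * Delta ^+ denom l0.
    case: lr => {l0 r0} [_ _ []|b c].
      rewrite !numer_nseq /denom !count_nseq !mul0n /numer !big_seq1.
      by rewrite x_powE.
    by rewrite numer_inv /numer big_nil /denom /= mul1g mulg1; case: c.
  have insert k e (a b c : M) :
      a * (b * c) * Delta ^+ (k + e) = a * (b * Delta ^+ k * c) * Delta ^+ e.
    by rewrite expgnDr !mulgA -(mulgA (a * b) (Delta ^+ k)) -Dpow !mulgA.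
  rewrite -!/(denom _) [in LHS]addnCA [in RHS]addnCA.
  by rewrite (insert (denom r0)) (insert (denom l0)) E.
(* Transitivity: the denominator of the middle word is inserted and then cancelled. *)
apply: (torus_cancel_r n_ge2 n_lt_m nm_coprime (a := Delta ^+ denom v)).
have swap k e (a : M) : a * Delta ^+ k * Delta ^+ e = a * Delta ^+ e * Delta ^+ k.
  by rewrite -!mulgA -!expgnDr addnC.
by rewrite swap IHuv swap IHvw swap.
Qed.

Definition knot_embed : M -> T := torus_embed (knot_gen true) (knot_gen false).

Lemma knot_embedM : {morph knot_embed : a b / a * b}.
Proof. exact (torus_embedM n_ge2 n_lt_m nm_coprime knot_gen_rel). Qed.

Lemma knot_embed1 : knot_embed 1 = 1.
Proof. exact (torus_embed1 n_ge2 n_lt_m nm_coprime knot_gen_rel). Qed.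

Lemma knot_embedX a k : knot_embed (a ^+ k) = knot_embed a ^+ k.
Proof. exact (torus_embedX n_ge2 n_lt_m nm_coprime knot_gen_rel a k). Qed.

Lemma knot_embed_rho i : (0 < i <= n)%N ->
  knot_embed (rhog n m i) = knot_gen true ^+ i / knot_gen false ^+ alpha i.
Proof. exact (torus_embed_rho n_ge2 n_lt_m nm_coprime knot_gen_rel (i := i)). Qed.

Lemma knot_embed_x : knot_embed x = knot_gen true.
Proof. exact (torus_embed_x n_ge2 n_lt_m nm_coprime knot_gen_rel). Qed.

Lemma knot_embed_y : knot_embed y = knot_gen false.
Proof. exact (torus_embed_y n_ge2 n_lt_m nm_coprime knot_gen_rel). Qed.

(** An explicit group word for the image, whose numerator and denominator can be computed. *)
Definition embed_word (u : seq 'I_n.-1.+1) : seq (bool * bool) :=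
  flatten [seq nseq (val l).+1 (true, false) ++ nseq (alpha (val l).+1) (false, true)
          | l <- u].

Lemma embed_word_cons l u : embed_word (l :: u) =
  (nseq l.+1 (true, false) ++ nseq (alpha l.+1) (false, true)) ++ embed_word u.
Proof. by []. Qed.

Lemma embed_wordE u :
  knot_embed (word_class (@torus_monoid_rel n m) u) = word_class grel (embed_word u).
Proof.
elim: u => [|l u IH]; first exact: knot_embed1.
rewrite word_class_cons knot_embedM IH embed_word_cons.
rewrite !word_class_catM !word_class_nseq torus_genE knot_embed_rho; last exact: ord_range.
by rewrite -expVgn pgen_inv.
Qed.

(** A letter contributes x^i y^((m-1) alpha i) = rho_i y^(m alpha i) = rho_i Delta^(alpha i). *)
Lemma numer_embed_word u :
  numer (embed_word u) =
  word_class (@torus_monoid_rel n m) u * Delta ^+ denom (embed_word u).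
Proof.
elim: u => [|l u IH]; first by rewrite /numer big_nil mulg1.
rewrite word_class_cons embed_word_cons !numer_cat IH.
rewrite !numer_nseq /numer !big_seq1 torus_x_pow //; last exact: ord_range.
rewrite /denom !count_cat !count_nseq mul0n mul1n.
rewrite -(mulgA (rhog n m _)) -expgnA -expgnDr -mulSn (@prednK m); last by lia.
rewrite expgnA -torus_DeltaE torus_genE add0n expgnDr !mulgA.
rewrite -(mulgA _ (word_class _ u) (Delta ^+ alpha _)).
have central := central_pow (Delta_central n_ge2 n_lt_m nm_coprime).
by rewrite (central _ (word_class _ u)) !mulgA.
Qed.

(** Being a power of each generator, the image of Delta commutes with both. *)
Lemma knot_embed_Delta b : knot_embed Delta = knot_gen b ^+ (if b then n else m).
Proof.
by rewrite torus_DeltaE knot_embedX knot_embed_y; case: b; rewrite ?knot_gen_rel.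
Qed.

Lemma knot_letterE b c :
  pgen grel (b, c) = (if c then (knot_gen b)^-1 else knot_gen b) :> T.
Proof. by case: c => //; rewrite pgen_inv. Qed.

Lemma knot_Delta_central (g : T) : commute (knot_embed Delta) g.
Proof.
rewrite -(word_reprK g) word_class_prod; apply: commute_prod => -[b c] _.
have comm : commute (knot_embed Delta) (knot_gen b).
  by rewrite (knot_embed_Delta b); apply/commute_sym/commuteX/commute_refl.
by rewrite knot_letterE; case: c => //; apply: commuteV.
Qed.

(** Equal images have congruent words; cross-multiplying their numerators leaves the same power of
    Delta on both sides, to be cancelled. *)
Lemma knot_embed_inj : injective knot_embed.
Proof.
move=> a b; rewrite -(word_reprK a) -(word_reprK b) !embed_wordE.
move: (word_repr a) (word_repr b) => u v /word_classP /numer_pcong.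
rewrite !numer_embed_word -!mulgA -!expgnDr addnC.
exact: torus_cancel_r.
Qed.

Lemma knot_word_fraction u :
  word_class grel u * knot_embed Delta ^+ denom u = knot_embed (numer u).
Proof.
elim: u => [|[b c] u IH].
  by rewrite word_class_nil /numer big_nil mulg1 knot_embed1.
rewrite /numer big_cons -/(numer u) knot_embedM -IH !mulgA.
rewrite word_class_cons /denom /= -/(denom u) expgnDr !mulgA.
rewrite -(mulgA _ (word_class _ u) (_ ^+ c)).
rewrite (commuteX c (commute_sym (knot_Delta_central (word_class grel u)))) mulgA.
congr (_ * _ * _); rewrite knot_letterE (knot_embed_Delta b).
(* As the image of Delta is a power of each generator, multiplying an inverse letter by it gives the
   preceding power. *)
have predV k : (0 < k)%N -> (knot_gen b)^-1 * knot_gen b ^+ k = knot_gen b ^+ k.-1.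
  by case: k => // k _; rewrite expgS mulKg.
case: b c predV => [] [] predV /=; rewrite ?expg1 ?expg0 ?mulg1.
- by rewrite predV ?knot_embedX ?knot_embed_x //; lia.
- by rewrite knot_embed_x.
- by rewrite predV ?knot_embedX ?knot_embed_y //; lia.
- by rewrite knot_embed_y.
Qed.

Lemma knot_embed_fractions : is_group_of_fractions knot_embed.
Proof.
split; [by split; [apply: knot_embed1 | apply: knot_embedM] | exact: knot_embed_inj |].
move=> g; rewrite -(word_reprK g); set u := word_repr g.
exists (numer u), (Delta ^+ denom u); rewrite -knot_word_fraction.
by rewrite knot_embedX mulgK.
Qed.

(** The presentation of the knot group gives a map phi to [G] that restricts to [iota] on the
    monoid; as both groups consist of fractions, phi is bijective. *)
Lemma fractions_isomorphic (G : groupType) (iota : M -> G) :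
  is_group_of_fractions iota -> isomorphic_groups G T.
Proof.
case=> [[iota1 iotaM] iota_inj iota_surj].
have iotaX a k : iota (a ^+ k) = iota a ^+ k.
  by elim: k => [//|k IH]; rewrite !expgS iotaM IH.
have st : iota x ^+ n = iota y ^+ m by rewrite -!iotaX x_powE.
pose phi := @knot_lift n m G (iota x) (iota y).
have phiM : {morph phi : a b / a * b} by apply: knot_liftM.
have phi_embed a : phi (knot_embed a) = iota a.
  rewrite -(word_reprK a); elim: (word_repr a) => [|l u IH].
    by rewrite word_class_nil iota1 knot_embed1 [LHS]knot_lift1.
  rewrite word_class_cons iotaM knot_embedM phiM IH; congr (_ * _).
  rewrite torus_genE knot_embed_rho ?phiM; last exact: ord_range.
  rewrite /phi !(knot_liftV, knot_liftX) // !knot_lift_gen //.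
  by rewrite -!iotaX torus_x_pow ?ord_range // iotaM mulgK.
have phiV a : phi a^-1 = (phi a)^-1 by apply: knot_liftV.
have [_ _ knot_surj] := knot_embed_fractions.
(* If g / h is the fraction of a by b, then iota a = iota b, so a = b and g / h is trivial. *)
have phi_inj : injective phi.
  move=> g h gh; apply: divg1_eq; have [a [b abE]] := knot_surj (g / h).
  have : phi (g / h) = 1 by rewrite phiM phiV gh mulgV.
  rewrite abE phiM phiV !phi_embed => /divg1_eq/iota_inj ->.
  exact: mulgV.
have phi_surj g : exists h, phi h = g.
  have [a [b ->]] := iota_surj g.
  by exists (knot_embed a / knot_embed b); rewrite phiM phiV !phi_embed.
(* A pointwise chosen section of phi is multiplicative because phi is injective. *)
have [psi psiK] := choice phi_surj.
have psiM : {morph psi : g h / g * h}.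
  by move=> g h; apply: phi_inj; rewrite phiM !psiK.
pose psi_mul := isMultiplicative.Build G T psi psiM.
exists (HB.pack psi psi_mul : {multiplicative G -> T}).
exists phi => [g|g] /=; first exact: psiK.
by apply: phi_inj; rewrite psiK.
Qed.

End TorusKnotGroup.

(** The isomorphism is claimed for every group of fractions; the existence clause keeps that claim
    from being vacuous. *)
Theorem theorem6p4 (n m : nat) (n_ge2 : 2 <= n) (n_lt_m : n < m)
    (nm_coprime : coprime n m) :
  is_garside_monoid (torus_Delta n m) /\
  (exists (G : groupType) (iota : torus_monoid n m -> G),
     is_group_of_fractions iota) /\
  (forall (G : groupType) (iota : torus_monoid n m -> G),
     is_group_of_fractions iota -> isomorphic_groups G (torus_knot_group n m)).
Proof.
split; first exact: torus_garside.
split; last by move=> G iota; apply: fractions_isomorphic.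
by exists (torus_knot_group n m), (@knot_embed n m); apply: knot_embed_fractions.
Qed.
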